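(* Let $((F^k,\|\cdot\|_k):k\in\mathbb N)$ be a dual multi-normed space, where $F$ is a complex normed space. For each $k\in\mathbb N$, let $\|\cdot\|_k'$ be the dual norm on $(F')^k$ given by $$\|(\lambda_1,\dots,\lambda_k)\|_k'=\sup\Big\{\Big|\sum_{j=1}^k\langle x_j,\lambda_j\rangle\Big| : x_1,\dots,x_k\in F,\ \|(x_1,\dots,x_k)\|_k\le 1\Big\}\quad(\lambda_1,\dots,\lambda_k\in F').$$ Then $(((F')^k,\|\cdot\|_k'):k\in\mathbb N)$ is a multi-Banach space.
   Context: Let $(E,\|\cdot\|)$ be a complex normed space with dual space $E'$, and let $\mathfrak S_k$ be the group of permutations of $\{1,\dots,k\}$. Consider a sequence $(\|\cdot\|_k:k\in\mathbb N)$ such that $\|\cdot\|_k$ is a norm on $E^k$ for each $k$ and $\|x\|_1=\|x\|$ for $x\in E$. Consider the following axioms, imposed for each $k\ge2$: (A1) $\|(x_{\sigma(1)},\dots,x_{\sigma(k)})\|_k=\|(x_1,\dots,x_k)\|_k$ for all $\sigma\in\mathfrak S_k$ and $x_1,\dots,x_k\in E$; (A2) $\|(\alpha_1x_1,\dots,\alpha_kx_k)\|_k\le(\max_i|\alpha_i|)\,\|(x_1,\dots,x_k)\|_k$ for all $\alpha_1,\dots,\alpha_k\in\mathbb C$ and $x_1,\dots,x_k\in E$; (A3) $\|(x_1,\dots,x_{k-1},0)\|_k=\|(x_1,\dots,x_{k-1})\|_{k-1}$ for all $x_1,\dots,x_{k-1}\in E$; (A4) $\|(x_1,\dots,x_{k-2},x_{k-1},x_{k-1})\|_k=\|(x_1,\dots,x_{k-2},x_{k-1})\|_{k-1}$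 for all $x_1,\dots,x_{k-1}\in E$; (B4) $\|(x_1,\dots,x_{k-2},x_{k-1},x_{k-1})\|_k=\|(x_1,\dots,x_{k-2},2x_{k-1})\|_{k-1}$ for all $x_1,\dots,x_{k-1}\in E$. The family $((E^k,\|\cdot\|_k):k\in\mathbb N)$ is a multi-normed space if (A1)–(A4) hold, and a dual multi-normed space if (A1), (A2), (A3), (B4) hold; it is a multi-Banach space, respectively a dual multi-Banach space, if moreover $(E,\|\cdot\|)$ is complete. *)

(* Defs.v *)
From HB Require Import structures.
From mathcomp Require Import all_boot all_order all_algebra all_fingroup.
From mathcomp Require Import complex.
From mathcomp Require Import all_classical all_reals all_analysis.

Set Implicit Arguments.
Unset Strict Implicit.
Unset Printing Implicit Defensive.

Import Order.TTheory GRing.Theory Num.Theory.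
Import numFieldNormedType.Exports.
Import ComplexField.Normc.

Local Open Scope classical_set_scope.
Local Open Scope ring_scope.
Local Open Scope complex_scope.

Section ComplexModulus.
Variable R : realType.
Implicit Types z w : R[i].

Lemma normCE z : `|z| = (normc z)%:C.
Proof. by []. Qed.

Lemma normc_ge0 z : 0 <= normc z.
Proof. by have := normr_ge0 z; rewrite normCE lecR. Qed.

Lemma ler_normcD z w : normc (z + w) <= normc z + normc w.
Proof. by have := ler_normD z w; rewrite !normCE -rmorphD lecR. Qed.

End ComplexModulus.

(* The dual space F' of continuous linear functionals, with the operator
   norm.  Norms in [normedModType R[i]] take their values in [R[i]], so the
   real-valued [opnorm] is embedded by [%:C] in the instance. *)
Section ContinuousDual.
Variables (R : realType) (F : normedModType R[i]).

Definition continuous_functional : {pred F -> R[i]^o} :=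
  [pred f : F -> R[i]^o | `[< linear f /\ continuous f >]].

Lemma continuous_functionalP (f : F -> R[i]^o) :
  reflect (linear f /\ continuous f) (f \in continuous_functional).
Proof. exact: asboolP. Qed.

Lemma continuous_functional_submod : submod_closed continuous_functional.
Proof.
split=> [|a f g].
  apply/continuous_functionalP; split=> [a u v|x]; last exact: cvg_cst.
  by rewrite scaler0 addr0.
move=> /continuous_functionalP[lf cf] /continuous_functionalP[lg cg].
apply/continuous_functionalP; split.
  move=> b u v.
  rewrite -[LHS]/(a *: f (b *: u + v) + g (b *: u + v)).
  rewrite -[RHS]/(b *: (a *: f u + g u) + (a *: f v + g v)).
  by rewrite lf lg !scalerDr !scalerA (mulrC b a) addrACA.
move=> x; apply: cvgD; last exact: cg.
by apply: cvgZr; exact: cf.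
Qed.

HB.instance Definition _ := GRing.isSubmodClosed.Build R[i] (F -> R[i]^o)
  continuous_functional continuous_functional_submod.

Record dual := Dual {
  dual_fun :> F -> R[i]^o;
  dual_funP : dual_fun \in continuous_functional }.

HB.instance Definition _ := [isSub for dual_fun].
HB.instance Definition _ := [Choice of dual by <:].
HB.instance Definition _ := [SubChoice_isSubLmodule of dual by <:].

Lemma dual_linear (l : dual) : linear l.
Proof. by have /continuous_functionalP[] := dual_funP l. Qed.

HB.instance Definition _ (l : dual) :=
  GRing.isLinear.Build R[i] F R[i]^o *:%R (dual_fun l) (dual_linear l).

Lemma dual_continuous (l : dual) : continuous l.
Proof. by have /continuous_functionalP[] := dual_funP l. Qed.

Definition opnorm (l : dual) : R :=
  sup [set normc (l x) | x in [set x : F | `|x| <= 1]].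

Lemma opnorm_has_sup (l : dual) :
  has_sup [set normc (l x) | x in [set x : F | `|x| <= 1]].
Proof.
split; first by exists (normc (l 0)); exists 0 => //=; rewrite normr0.
have /linear_bounded_continuous/bounded_funP/(_ 1)[M lM] := @dual_continuous l.
exists (complex.Re M) => _ [x /= x1 <-].
by have := lM x x1; rewrite normCE lecE => /andP[].
Qed.

Lemma le_opnorm (l : dual) (x : F) : `|l x| <= (opnorm l)%:C * `|x|.
Proof.
have [->|x0] := eqVneq x 0; first by rewrite linear0 !normr0 mulr0.
have nx0 : 0 < `|x| by rewrite normr_gt0.
rewrite -ler_pdivrMr//.
have -> : `|l x| / `|x| = `|l (`|x|^-1 *: x)|.
  by rewrite linearZ/= normrZ normrV ?unitfE ?normr_eq0// normr_id mulrC.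
rewrite normCE lecR; apply: sup_upper_bound; first exact: opnorm_has_sup.
exists (`|x|^-1 *: x) => //=.
by rewrite normrZ normrV ?unitfE ?normr_eq0// normr_id mulVf// normr_eq0.
Qed.

Lemma opnorm_le (l : dual) (M : R) :
  (forall x, `|x| <= 1 -> normc (l x) <= M) -> opnorm l <= M.
Proof.
move=> lM; apply: ge_sup; first exact: (opnorm_has_sup l).1.
by move=> _ [x /= x1 <-]; exact: lM.
Qed.

Lemma opnorm_ge (l : dual) x : `|x| <= 1 -> normc (l x) <= opnorm l.
Proof.
by move=> x1; apply: sup_upper_bound; [exact: opnorm_has_sup|exists x].
Qed.

Lemma dualDE (l m : dual) x : (l + m) x = l x + m x. Proof. by []. Qed.
Lemma dualZE a (l : dual) x : (a *: l) x = a * l x. Proof. by []. Qed.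

Lemma opnormD (l m : dual) :
  (opnorm (l + m))%:C <= (opnorm l)%:C + (opnorm m)%:C.
Proof.
rewrite -rmorphD lecR; apply: opnorm_le => x x1.
by rewrite dualDE (le_trans (ler_normcD _ _))// lerD// opnorm_ge.
Qed.

Lemma opnormZ (a : R[i]) (l : dual) :
  (opnorm (a *: l))%:C = `|a| * (opnorm l)%:C.
Proof.
have le_opnormZ b (m : dual) : opnorm (b *: m) <= normc b * opnorm m.
  apply: opnorm_le => x x1; rewrite dualZE normcM.
  by rewrite ler_wpM2l ?normc_ge0 ?opnorm_ge.
rewrite normCE -rmorphM; congr (_%:C); apply: le_anti.
rewrite le_opnormZ/=; have [->|a0] := eqVneq a 0.
  rewrite normc0 mul0r (le_trans (normc_ge0 ((0 *: l) 0)))//.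
  by rewrite opnorm_ge ?normr0.
have na0 : 0 < normc a.
  by rewrite lt_def normc_ge0 andbT; apply: contra_neq a0 => /eq0_normc.
rewrite mulrC -ler_pdivlMr// mulrC -normcV.
by have := le_opnormZ a^-1 (a *: l); rewrite scalerA mulVf// scale1r.
Qed.

Lemma opnorm_eq0 (l : dual) : (opnorm l)%:C = 0 -> l = 0.
Proof.
move=> l0; apply/val_inj/funext => x; apply/eqP.
by rewrite -normr_le0 (le_trans (le_opnorm l x))// l0 mul0r.
Qed.

HB.instance Definition _ :=
  Lmodule_isNormed.Build R[i] dual opnormD opnormZ opnorm_eq0.

End ContinuousDual.

Arguments dual {R} F.

Section MultiNorms.
Variable R : realType.

(* Nonnegativity and [p 0 = 0] follow from these three conditions. *)
Record is_norm (V : lmodType R[i]) (p : V -> R) : Prop := IsNorm {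
  is_normD : forall x y, p (x + y) <= p x + p y;
  is_normZ : forall (a : R[i]) x, p (a *: x) = normc a * p x;
  is_norm_eq0 : forall x, p x = 0 -> x = 0 }.

Section NormSequences.
Variable E : normedModType R[i].

Definition rcons_ffun k (x : {ffun 'I_k -> E}) (y : E) :
    {ffun 'I_k.+1 -> E} :=
  [ffun i => if unlift ord_max i is Some j then x j else y].

(* [N k] is the norm on [E^k].  Since [k] ranges over the positive integers,
   [N 0] is unconstrained, and "k >= 2" is rendered by writing [k] as
   [m.+2]. *)
Variable N : forall k, {ffun 'I_k -> E} -> R.
Arguments N : clear implicits.

Definition norm_sequence : Prop :=
  (forall k, is_norm (N k.+1)) /\
  (forall x : E, (N 1%N [ffun=> x])%:C = `|x|).

Definition law_A1 : Prop :=
  forall m (s : 'S_m.+2) (x : {ffun 'I_m.+2 -> E}),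
    N m.+2 [ffun i => x (s i)] = N m.+2 x.

Definition law_A2 : Prop :=
  forall m (a : 'I_m.+2 -> R[i]) (x : {ffun 'I_m.+2 -> E}),
    N m.+2 [ffun i => a i *: x i] <=
      (\big[Num.max/0]_(i < m.+2) normc (a i)) * N m.+2 x.

Definition law_A3 : Prop :=
  forall m (x : {ffun 'I_m.+1 -> E}), N m.+2 (rcons_ffun x 0) = N m.+1 x.

Definition law_A4 : Prop :=
  forall m (x : {ffun 'I_m -> E}) (y : E),
    N m.+2 (rcons_ffun (rcons_ffun x y) y) = N m.+1 (rcons_ffun x y).

Definition law_B4 : Prop :=
  forall m (x : {ffun 'I_m -> E}) (y : E),
    N m.+2 (rcons_ffun (rcons_ffun x y) y) = N m.+1 (rcons_ffun x (2 *: y)).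

Definition multi_normed : Prop :=
  [/\ norm_sequence, law_A1, law_A2, law_A3 & law_A4].

Definition dual_multi_normed : Prop :=
  [/\ norm_sequence, law_A1, law_A2, law_A3 & law_B4].

Definition multi_Banach : Prop :=
  multi_normed /\
  (forall G : set_system E, ProperFilter G -> cauchy G -> cvg G).

End NormSequences.

(* [sup] of an unbounded set is 0 by convention.  An unbounded set can only
   arise from a nonzero [l], for which the value 0 contradicts [is_norm_eq0];
   so finiteness of the supremum is part of [dual_norm N] being norms. *)
Definition dual_norm (F : normedModType R[i])
    (N : forall k, {ffun 'I_k -> F} -> R) k (l : {ffun 'I_k -> dual F}) : R :=
  sup [set normc (\sum_(j < k) l j (x j)) |
         x in [set x : {ffun 'I_k -> F} | N k x <= 1]].

End MultiNorms.

(* Main.v *)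
(* The pairing [<x, l> = sum_j <x_j, l_j>] turns each axiom for the dual norms
   into a statement about the unit balls of the norms [N k]: (A1), (A2) and
   (A3) are self-dual, while (B4) says that addition
   [(x, y, z) |-> (x, y + z)] maps the unit ball of [F^(k+1)] onto that of
   [F^k], and its adjoint is [(l, m) |-> (l, m, m)].  The suprema are finite
   because each coordinate of [x] is bounded by [N k x].  Completeness of [F']
   is the usual argument: a Cauchy filter converges pointwise, uniformly on the
   unit ball. *)
Require Import Defs.
From HB Require Import structures.
From mathcomp Require Import all_boot all_order all_algebra all_fingroup.
From mathcomp Require Import complex.
From mathcomp Require Import all_classical all_reals all_analysis.
From mathcomp Require Import ring lra.
Import Order.TTheory GRing.Theory Num.Theory.
Import numFieldNormedType.Exports ComplexField.Normc.

Set Implicit Arguments.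
Unset Strict Implicit.
Unset Printing Implicit Defensive.

Local Open Scope classical_set_scope.
Local Open Scope ring_scope.
Local Open Scope complex_scope.

(** * Completeness of the dual space *)

Section DualComplete.
Variable R : realType.

Lemma le_normc_Re (z : R[i]) : `|complex.Re z| <= normc z.
Proof.
case: z => a b /=; rewrite -sqrtr_sqr ler_wsqrtr// lerDl sqr_ge0//.
Qed.

Lemma le_normc_Im (z : R[i]) : `|complex.Im z| <= normc z.
Proof.
case: z => a b /=; rewrite -sqrtr_sqr ler_wsqrtr// lerDr sqr_ge0//.
Qed.

Lemma normc_le_ReIm (z : R[i]) : normc z <= `|complex.Re z| + `|complex.Im z|.
Proof.
case: z => a b /=.
rewrite -[leRHS]ger0_norm ?addr_ge0// -[leRHS]sqrtr_sqr ler_wsqrtr//.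
have [a0 b0] := (normr_ge0 a, normr_ge0 b).
by rewrite -(real_normK (num_real a)) -(real_normK (num_real b)); nra.
Qed.

Section PointwiseLimit.
Variables (T : Type) (G : set_system T) (PG : ProperFilter G).

(** Completeness of [R] applied to the image filter; the Cauchy condition takes the form in which
    the centre may vary with the radius [e]. *)
Lemma real_cauchy_lim (f : T -> R) :
  (forall e : R, 0 < e -> exists a, \forall t \near G, `|f t - a| < e) ->
  exists a, forall e, 0 < e -> \forall t \near G, `|f t - a| < e.
Proof.
move=> fC; have : cauchy (f @ G).
  apply/cauchyP => e e0; have [a fa] := fC e e0.
  by exists a; apply: filterS fa => t; rewrite /ball/= distrC.
move=> /cauchy_cvgP/cvg_ex[a /cvgrPdist_lt fa].
by exists a => e /fa; apply: filterS => t; rewrite distrC.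
Qed.

(** The modulus dominates the real and imaginary parts and is at most the sum of their absolute
    values, so the two parts converge separately. *)
Lemma complex_cauchy_lim (f : T -> R[i]) :
  (forall e : R, 0 < e -> exists z, \forall t \near G, normc (f t - z) < e) ->
  exists z, forall e, 0 < e -> \forall t \near G, normc (f t - z) < e.
Proof.
move=> fC.
have [a fa] : exists a, forall e, 0 < e ->
    \forall t \near G, `|complex.Re (f t) - a| < e.
  apply: real_cauchy_lim => e /fC[z fz]; exists (complex.Re z).
  apply: filterS fz => t; apply: le_lt_trans.
  by have := le_normc_Re (f t - z); rewrite raddfB.
have [b fb] : exists b, forall e, 0 < e ->
    \forall t \near G, `|complex.Im (f t) - b| < e.
  apply: real_cauchy_lim => e /fC[z fz]; exists (complex.Im z).
  apply: filterS fz => t; apply: le_lt_trans.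
  by have := le_normc_Im (f t - z); rewrite raddfB.
exists (a +i* b) => e e0.
have e20 : 0 < e / 2 by lra.
apply: filterS2 (fa _ e20) (fb _ e20) => t ta tb.
have := normc_le_ReIm (f t - (a +i* b)); rewrite !raddfB/=; lra.
Qed.

End PointwiseLimit.

Lemma dual_normE (F : normedModType R[i]) (l : dual F) :
  `|l| = (opnorm l)%:C.
Proof. by []. Qed.

Lemma opnorm_ge0 (F : normedModType R[i]) (l : dual F) : 0 <= opnorm l.
Proof. by have := normr_ge0 l; rewrite dual_normE lecR. Qed.

(** Comparable elements of [R[i]] have equal imaginary parts. Hence radii of balls over [R[i]] can
    be handled in [R]. *)
Lemma complex_gt0 (e : R[i]) : 0 < e -> exists2 r : R, 0 < r & e = r%:C.
Proof.
case: e => a b; rewrite ltcE/= => /andP[/eqP -> a0].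
by exists a.
Qed.

Lemma normed_normE (F : normedModType R[i]) (x : F) :
  `|x| = (complex.Re `|x|)%:C.
Proof.
have : 0 <= `|x| by [].
by case: `|x| => a b; rewrite lecE/= => /andP[/eqP -> _].
Qed.

Lemma Re_norm_ge0 (F : normedModType R[i]) (x : F) : 0 <= complex.Re `|x|.
Proof. by have := normr_ge0 x; rewrite [in leRHS]normed_normE lecR. Qed.

Lemma dual_complete (F : normedModType R[i]) (G : set_system (dual F)) :
  ProperFilter G -> cauchy G -> cvg G.
Proof.
move=> PG /cauchyP cG.
have {}cG (e : R) : 0 < e ->
    exists l0 : dual F, \forall l \near G, opnorm (l - l0) < e.
  move=> e0; have [|l0 Gl0] := cG e%:C; first by rewrite ltcR.
  exists l0; apply: filterS Gl0 => l.
  by rewrite -ball_normE/= distrC dual_normE ltcR.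
have opB (l m : dual F) x :
    normc (l x - m x) <= opnorm (l - m) * complex.Re `|x|.
  have := le_opnorm (l - m) x; rewrite [in X in _ * X]normed_normE.
  by rewrite normCE -rmorphM lecR.
have /choice[L GL] : forall x : F, exists z : R[i], forall e, 0 < e ->
    \forall l \near G, normc ((l : dual F) x - z) < e.
  move=> x; apply: complex_cauchy_lim => e e0.
  have n0 := Re_norm_ge0 x.
  (* The [+ 1] keeps the denominator positive at [x = 0]. *)
  have [|l0 Gl0] := cG (e / (complex.Re `|x| + 1)).
    by rewrite divr_gt0//; lra.
  exists (l0 x); apply: filterS Gl0 => l.
  rewrite ltr_pdivlMr; last lra.
  move=> h; apply: le_lt_trans (opB _ _ _) _.
  have := opnorm_ge0 (l - l0); nra.
(* Uniformity in [x]: the functional [l] compared with both [l0] and [L] is chosen after [x], but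
   its distance [e] to [l0] is not; the pointwise error [d] is arbitrary. *)
have L_bound (l0 : dual F) (e : R) : (\forall l \near G, opnorm (l - l0) < e) ->
    forall x, normc (L x - l0 x) <= e * complex.Re `|x|.
  move=> Gl0 x.
  have n0 := Re_norm_ge0 x.
  apply/ler_addgt0Pr => d d0.
  have [l [l1 l2]] := filter_ex (filterI Gl0 (GL x _ d0)).
  have -> : L x - l0 x = (l x - l0 x) - (l x - L x) by ring.
  apply: le_trans (ler_normcD _ _) _; rewrite normcN lerD ?(ltW l2)//.
  by apply: le_trans (opB _ _ _) _; rewrite ler_wpM2r// ltW.
have L_linear : linear (L : F -> R[i]^o).
  move=> a u v; apply/eqP; rewrite -subr_eq0; apply/eqP/eq0_normc/eqP.
  rewrite eq_le normc_ge0 andbT; apply/ler_addgt0Pr => d d0; rewrite add0r.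
  (* Total weight [normc a + 1 + 1] of the three pointwise errors, at [u], [v] and [a *: u + v]. *)
  pose c := normc a + 2.
  have c0 : 0 < c by rewrite /c; have := normc_ge0 a; lra.
  have dc0 : 0 < d / c by rewrite divr_gt0.
  have [l [[lu lv] luv]] := filter_ex
    (filterI (filterI (GL u _ dc0) (GL v _ dc0)) (GL (a *: u + v) _ dc0)).
  have -> : L (a *: u + v) - (a *: (L u : R[i]^o) + L v) =
      a * (l u - L u) + (l v - L v) - (l (a *: u + v) - L (a *: u + v)).
    by rewrite dual_linear /GRing.scale/=; ring.
  apply: le_trans (ler_normcD _ _) _; rewrite normcN.
  have := ler_normcD (a * (l u - L u)) (l v - L v); rewrite normcM.
  have := normc_ge0 a.
  have -> : d = (d / c) * normc a + d / c + d / c.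
    by rewrite /c; field; rewrite gt_eqF.
  by nra.
have L_cont : continuous (L : F -> R[i]^o).
  (* A single approximant at distance 1 bounds [L], with constant [opnorm l0 + 1]. *)
  have [l0 Gl0] := cG 1 ltr01.
  pose Llin := GRing.isLinear.Build R[i] F R[i]^o *:%R L L_linear.
  pose LL : {linear F -> R[i]^o} := HB.pack L Llin.
  apply: (@bounded_linear_continuous _ _ _ LL).
  apply/linear_boundedP; exists ((opnorm l0 + 1)%:C); split.
    by rewrite realE lecR addr_ge0// opnorm_ge0.
  move=> r lt_r x; apply: le_trans (ler_wpM2r (normr_ge0 _) (ltW lt_r)).
  rewrite normCE [in leRHS]normed_normE -rmorphM lecR.
  have -> : LL x = (L x - l0 x) + l0 x by rewrite subrK.
  apply: le_trans (ler_normcD _ _) _; rewrite mulrDl addrC lerD//.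
    by have := le_opnorm l0 x; rewrite normed_normE normCE -rmorphM lecR.
  exact: L_bound.
have memL : (L : F -> R[i]^o) \in @continuous_functional R F.
  exact/continuous_functionalP.
apply/cvg_ex; exists (Dual memL); apply/fcvg_ballP => e /complex_gt0[r r0 ->].
(* Half the radius goes from [L] to the centre [l0], the other half from [l0] to [l]. *)
have r20 : 0 < r / 2 by lra.
have [l0 Gl0] := cG _ r20.
have l0L : opnorm (Dual memL - l0) <= r / 2.
  apply: opnorm_le => x x1; apply: le_trans (L_bound _ _ Gl0 x) _.
  by rewrite -[leRHS]mulr1 ler_wpM2l ?(ltW r20)// -lecR -normed_normE.
apply: filterS Gl0 => l l0l; rewrite -ball_normE/= dual_normE ltcR.
have := opnormD (Dual memL - l0) (l0 - l); rewrite addrA subrK -rmorphD lecR.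
have -> : opnorm (l0 - l) = opnorm (l - l0).
  by apply/complexI; rewrite -!dual_normE distrC.
by move: l0L l0l; lra.
Qed.
End DualComplete.

(** * Tuples and the pairing of [F^k] with its dual *)

Section DualNorm.
Variables (R : realType) (F : normedModType R[i]).

Lemma is_norm0 (V : lmodType R[i]) (p : V -> R) : is_norm p -> p 0 = 0.
Proof. by move=> np; rewrite -(scale0r 0) (is_normZ np) normc0 mul0r. Qed.

Lemma is_norm_ge0 (V : lmodType R[i]) (p : V -> R) x : is_norm p -> 0 <= p x.
Proof.
(* The triangle inequality for [x] and [-x] gives [0 <= p x + p x]. *)
move=> np; have := is_normD np x (-1 *: x).
rewrite (is_normZ np) scaleN1r subrr (is_norm0 np) normcN normc1; lra.
Qed.

Lemma rcons_ffun_lift (E : normedModType R[i]) k (x : {ffun 'I_k -> E}) y i :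
  rcons_ffun x y (lift ord_max i) = x i.
Proof. by rewrite ffunE liftK. Qed.

Lemma rcons_ffun_max (E : normedModType R[i]) k (x : {ffun 'I_k -> E}) y :
  rcons_ffun x y ord_max = y.
Proof. by rewrite ffunE unlift_none. Qed.

Definition belast_ffun (E : normedModType R[i]) k (x : {ffun 'I_k.+1 -> E}) :
    {ffun 'I_k -> E} := [ffun i => x (lift ord_max i)].

Lemma rcons_belast (E : normedModType R[i]) k (x : {ffun 'I_k.+1 -> E}) :
  rcons_ffun (belast_ffun x) (x ord_max) = x.
Proof.
apply/ffunP => i; rewrite ffunE.
by case: unliftP => [j ->|->]; rewrite ?ffunE.
Qed.

Lemma rcons_ffunD (E : normedModType R[i]) k (x x' : {ffun 'I_k -> E}) y y' :
  rcons_ffun x y + rcons_ffun x' y' = rcons_ffun (x + x') (y + y').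
Proof.
by apply/ffunP => i; rewrite !ffunE; case: unlift => [j|//]; rewrite ffunE.
Qed.

Lemma rcons_ffunZ (E : normedModType R[i]) k a (x : {ffun 'I_k -> E}) y :
  a *: rcons_ffun x y = rcons_ffun (a *: x) (a *: y).
Proof.
by apply/ffunP => i; rewrite !ffunE; case: unlift => [j|//]; rewrite ffunE.
Qed.

Definition single (E : normedModType R[i]) k (i : 'I_k) (y : E) :
    {ffun 'I_k -> E} :=
  [ffun j => if j == i then y else 0].

Definition dual_pair k (l : {ffun 'I_k -> dual F}) (x : {ffun 'I_k -> F}) :
    R[i] :=
  \sum_(j < k) l j (x j).

Lemma dual_pair_single k (l : {ffun 'I_k -> dual F}) i y :
  dual_pair l (single i y) = l i y.
Proof.
rewrite /dual_pair (bigD1 i)//= ffunE eqxx big1 ?addr0// => j /negPf ji.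
by rewrite ffunE ji linear0.
Qed.

Lemma dual_pairD k (l m : {ffun 'I_k -> dual F}) x :
  dual_pair (l + m) x = dual_pair l x + dual_pair m x.
Proof.
by rewrite /dual_pair -big_split/=; apply: eq_bigr => j _; rewrite ffunE.
Qed.

Lemma dual_pairZ k a (l : {ffun 'I_k -> dual F}) x :
  dual_pair (a *: l) x = a * dual_pair l x.
Proof.
by rewrite /dual_pair mulr_sumr; apply: eq_bigr => j _; rewrite ffunE.
Qed.

Lemma dual_pairZr k a (l : {ffun 'I_k -> dual F}) x :
  dual_pair l (a *: x) = a * dual_pair l x.
Proof.
by rewrite /dual_pair mulr_sumr; apply: eq_bigr => j _; rewrite ffunE linearZ.
Qed.

Lemma dual_pair_rcons k (l : {ffun 'I_k -> dual F}) m x y :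
  dual_pair (rcons_ffun l m) (rcons_ffun x y) = dual_pair l x + m y.
Proof.
rewrite /dual_pair big_ord_recr/= !rcons_ffun_max; congr +%R.
apply: eq_bigr => j _.
have -> : widen_ord (leqnSn k) j = lift ord_max j.
  by apply/val_inj/esym/lift_max.
by rewrite !rcons_ffun_lift.
Qed.

(** * Coordinate estimates in a dual multi-normed space *)

Variable N : forall k, {ffun 'I_k -> F} -> R.
Arguments N : clear implicits.
Hypothesis dmN : dual_multi_normed N.

Let normN k : is_norm (N k.+1). Proof. by case: dmN => -[]. Qed.
Let N1 x : (N 1%N [ffun=> x])%:C = `|x|. Proof. by case: dmN => -[]. Qed.
Let A1 : law_A1 N. Proof. by case: dmN. Qed.
Let A2 : law_A2 N. Proof. by case: dmN. Qed.
Let A3 : law_A3 N. Proof. by case: dmN. Qed.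
Let B4 : law_B4 N. Proof. by case: dmN. Qed.

(** (A1) moves the entry to position 0, out of the way of the last coordinate; (A3) then strips
    final zeros one by one, down to [N 1]. *)
Lemma normN_single k (i : 'I_k.+1) (y : F) : (N k.+1 (single i y))%:C = `|y|.
Proof.
elim: k i => [|k IHk] i.
  by rewrite -N1; congr (N 1%N _)%:C; apply/ffunP => j; rewrite !ffunE !ord1.
have <- : N k.+2 (single ord0 y) = N k.+2 (single i y).
  rewrite -(A1 (tperm ord0 i)); congr (N k.+2 _).
  apply/ffunP => j; rewrite !ffunE.
  by rewrite -[X in _ == X](tpermR ord0 i) (inj_eq perm_inj).
rewrite -(IHk ord0) -(A3 (single (@ord0 k) y)); congr (N k.+2 _)%:C.
apply/ffunP => j; rewrite !ffunE; case: unliftP => [j' ->|->//].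
by rewrite ffunE -!(inj_eq (@ord_inj _)) lift_max.
Qed.

Lemma normN_contraction k (a : 'I_k.+2 -> R[i]) (x : {ffun 'I_k.+2 -> F}) :
  (forall i, normc (a i) <= 1) -> N k.+2 [ffun i => a i *: x i] <= N k.+2 x.
Proof.
move=> a1; apply: le_trans (A2 a x) _.
rewrite -[leRHS]mul1r ler_wpM2r ?is_norm_ge0//.
by apply: bigmax_le => // i _.
Qed.

(** Erasing all other coordinates is (A2) with coefficients 0 and 1. Length 1 is separate because
    (A2) starts at length 2. *)
Lemma normN_coord k (x : {ffun 'I_k.+1 -> F}) i : `|x i| <= (N k.+1 x)%:C.
Proof.
case: k x i => [|k] x i.
  have -> : x = [ffun=> x i] by apply/ffunP => j; rewrite ffunE !ord1.
  by rewrite N1 ffunE.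
rewrite -(normN_single i) lecR.
have -> : single i (x i) = [ffun j => (j == i)%:R *: x j].
  apply/ffunP => j; rewrite !ffunE.
  by case: eqP => [->|_]; rewrite ?scale1r ?scale0r.
by apply: normN_contraction => j; case: eqP; rewrite ?normc1 ?normc0.
Qed.

(** * The dual norm as a finite supremum and as a norm *)

Local Notation "'N'' l" := (dual_norm N l) (at level 10, l at level 8).

Lemma dual_norm_has_sup k (l : {ffun 'I_k.+1 -> dual F}) :
  has_sup [set normc (dual_pair l x) | x in [set x | N k.+1 x <= 1]].
Proof.
split; first by exists (normc (dual_pair l 0)); exists 0; rewrite //= is_norm0.
(* On the unit ball every coordinate has norm at most 1, so each term is bounded by its operator
   norm. *)
exists (\sum_(j < k.+1) opnorm (l j)) => _ [x /= x1 <-].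
rewrite -lecR -normCE rmorph_sum/= (le_trans (ler_norm_sum _ _ _))//.
apply: ler_sum => j _; rewrite normCE lecR opnorm_ge//.
by apply: le_trans (normN_coord x j) _; rewrite -[1]/(1%:C) lecR.
Qed.

Lemma dual_norm_ge k (l : {ffun 'I_k.+1 -> dual F}) x :
  N k.+1 x <= 1 -> normc (dual_pair l x) <= N' l.
Proof.
by move=> x1; apply: sup_upper_bound; [exact: dual_norm_has_sup|exists x].
Qed.

Lemma dual_norm_le k (l : {ffun 'I_k.+1 -> dual F}) M :
  (forall x, N k.+1 x <= 1 -> normc (dual_pair l x) <= M) -> N' l <= M.
Proof.
move=> lM; apply: ge_sup; first exact: (dual_norm_has_sup l).1.
by move=> _ [x /= x1 <-]; exact: lM.
Qed.

Lemma dual_norm_ge0 k (l : {ffun 'I_k.+1 -> dual F}) : 0 <= N' l.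
Proof.
apply: le_trans (normc_ge0 (dual_pair l 0)) (dual_norm_ge _ _).
by rewrite is_norm0.
Qed.

(** Inclusion of the sets of values. For (A1), (A3) and (A4) it leaves only the task of transporting
    a unit-ball vector through the adjoint map. *)
Lemma le_dual_norm k m (l : {ffun 'I_k.+1 -> dual F})
    (l' : {ffun 'I_m.+1 -> dual F}) :
  (forall x, N k.+1 x <= 1 ->
    exists2 x', N m.+1 x' <= 1 & dual_pair l x = dual_pair l' x') ->
  N' l <= N' l'.
Proof.
move=> ll'; apply: dual_norm_le => x /ll'[x' x'1 ->]; exact: dual_norm_ge.
Qed.

(** Rescaling to the unit ball. It serves (A2), where the transported vector lies in a ball of
    another radius. *)
Lemma normc_dual_pair k (l : {ffun 'I_k.+1 -> dual F}) x :
  normc (dual_pair l x) <= N' l * N k.+1 x.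
Proof.
have [Nx0|Nx0] := eqVneq (N k.+1 x) 0.
  rewrite (is_norm_eq0 (normN k) Nx0) is_norm0// mulr0.
  by rewrite -(scale0r 0) dual_pairZr mul0r normc0.
have Nx_gt0 : 0 < N k.+1 x by rewrite lt_def Nx0 is_norm_ge0.
have nV : normc ((N k.+1 x)^-1)%:C = (N k.+1 x)^-1.
  by rewrite /= expr0n addr0 sqrtr_sqr ger0_norm// invr_ge0 ltW.
rewrite -ler_pdivrMr// mulrC -[X in X * _]nV -normcM -dual_pairZr.
by apply: dual_norm_ge; rewrite (is_normZ (normN k)) nV mulVf.
Qed.

(** Vectors supported at [i] keep their norm, so they are test vectors for the supremum.
    Definiteness of the dual norm follows. *)
Lemma opnorm_le_dual_norm k (l : {ffun 'I_k.+1 -> dual F}) i :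
  opnorm (l i) <= N' l.
Proof.
apply: opnorm_le => x x1; rewrite -dual_pair_single; apply: dual_norm_ge.
by rewrite -lecR normN_single.
Qed.

Lemma dual_norm_is_norm k : is_norm (@dual_norm R F N k.+1).
Proof.
split=> [l m|a l|l l0].
- apply: dual_norm_le => x x1; rewrite dual_pairD (le_trans (ler_normcD _ _))//.
  by rewrite lerD// dual_norm_ge.
- have leZ b (m : {ffun 'I_k.+1 -> dual F}) : N' (b *: m) <= normc b * N' m.
    apply: dual_norm_le => x x1; rewrite dual_pairZ normcM.
    by rewrite ler_wpM2l ?normc_ge0 ?dual_norm_ge.
  (* For nonzero [a] the reverse inequality is [leZ] for [a^-1] and [a *: l]. *)
  apply/le_anti; rewrite leZ/=; have [->|a0] := eqVneq a 0.
    by rewrite normc0 mul0r dual_norm_ge0.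
  have na0 : 0 < normc a.
    by rewrite lt_def normc_ge0 andbT; apply: contra_neq a0 => /eq0_normc.
  rewrite mulrC -ler_pdivlMr// mulrC -normcV.
  by have := leZ a^-1 (a *: l); rewrite scalerA mulVf// scale1r.
- apply/ffunP => i; rewrite ffunE; apply: opnorm_eq0; congr (_%:C).
  by apply/le_anti; rewrite opnorm_ge0 -l0 opnorm_le_dual_norm.
Qed.

Lemma dual_norm1 (l : dual F) : (@dual_norm R F N 1%N [ffun=> l])%:C = `|l|.
Proof.
rewrite dual_normE; congr _%:C; apply/le_anti/andP; split.
  apply: dual_norm_le => x x1; rewrite /dual_pair big_ord1 ffunE.
  apply: opnorm_ge; apply: le_trans (normN_coord x _) _.
  by rewrite -[1]/(1%:C) lecR.
apply: opnorm_le => x x1; have -> : l x = @dual_pair 1 [ffun=> l] [ffun=> x].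
  by rewrite /dual_pair big_ord1 !ffunE.
by apply: dual_norm_ge; rewrite -lecR N1.
Qed.

(** * The multi-norm axioms for the dual norms *)

Lemma dual_norm_A1 : law_A1 (@dual_norm R F N).
Proof.
have le_perm m (s : 'S_m.+2) (l : {ffun 'I_m.+2 -> dual F}) :
    N' [ffun i => l (s i)] <= N' l.
  apply: le_dual_norm => x x1.
  (* The adjoint of permuting by [s] is permuting by the inverse of [s], an isometry by (A1). *)
  exists [ffun i => x ((s^-1)%g i)]; first by rewrite A1.
  rewrite /dual_pair [RHS](reindex_perm s)/=.
  by apply: eq_bigr => i _; rewrite !ffunE permK.
move=> m s l; apply/le_anti; rewrite le_perm/=.
have {1}-> : l = [ffun i => [ffun j => l (s j)] ((s^-1)%g i)].
  by apply/ffunP => i; rewrite !ffunE permKV.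
exact: le_perm.
Qed.

Lemma dual_norm_A2 : law_A2 (@dual_norm R F N).
Proof.
move=> m a l; apply: dual_norm_le => x x1.
(* A diagonal map is its own transpose, so (A2) for [N] applies to [x]. *)
have -> : dual_pair [ffun i => a i *: l i] x =
    dual_pair l [ffun i => a i *: x i].
  by apply: eq_bigr => i _; rewrite !ffunE linearZ.
apply: le_trans (normc_dual_pair _ _) _; rewrite mulrC.
rewrite ler_wpM2r ?dual_norm_ge0//.
apply: le_trans (A2 _ _) _; rewrite ler_piMr//.
by apply: bigmax_ge_id.
Qed.

(** Unit balls are exchanged by dropping the last coordinate, contractive by (A2) with last
    coefficient 0 followed by (A3), and by appending 0, isometric by (A3). *)
Lemma dual_norm_A3 : law_A3 (@dual_norm R F N).
Proof.
move=> m l; apply/le_anti/andP; split; apply: le_dual_norm => x x1.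
- exists (belast_ffun x).
    rewrite -A3; apply: le_trans x1.
    have -> : rcons_ffun (belast_ffun x) 0 =
        [ffun i => (i != ord_max)%:R *: x i].
      apply/ffunP => i; rewrite !ffunE; case: unliftP => [j ->|->].
        by rewrite ffunE eq_sym neq_lift scale1r.
      by rewrite eqxx scale0r.
    by apply: normN_contraction => i; case: eqP; rewrite ?normc1 ?normc0.
  by rewrite -[in LHS](rcons_belast x) dual_pair_rcons; exact: addr0.
- exists (rcons_ffun x 0); first by rewrite A3.
  by rewrite dual_pair_rcons linear0 addr0.
Qed.

Lemma normN_swap k (x : {ffun 'I_k -> F}) y z :
  N k.+2 (rcons_ffun (rcons_ffun x y) z) =
    N k.+2 (rcons_ffun (rcons_ffun x z) y).
Proof.
(* The last but one position. *)
pose p : 'I_k.+2 := lift ord_max ord_max.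
rewrite -(A1 (tperm ord_max p)); congr (N k.+2 _); apply/ffunP => i.
rewrite ffunE; case: tpermP => [->|->|/eqP i1 /eqP i2].
- by rewrite /p rcons_ffun_lift !rcons_ffun_max.
- by rewrite /p rcons_ffun_lift !rcons_ffun_max.
- rewrite !ffunE; case: unliftP i1 i2 => [j ->|->]; last by rewrite eqxx.
  rewrite (inj_eq lift_inj) => _.
  by rewrite !ffunE; case: unliftP => [j' //|->]; rewrite eqxx.
Qed.

Let half_half : 2^-1 + 2^-1 = 1 :> R[i].
Proof. by rewrite -div1r -splitr. Qed.

(* By (B4) the vector [(x, y + z)] has the norm of [(x, (y + z)/2, (y + z)/2)],
   the average of [(x, y, z)] and [(x, z, y)]. *)
Lemma normN_merge k (x : {ffun 'I_k -> F}) y z :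
  N k.+1 (rcons_ffun x (y + z)) <= N k.+2 (rcons_ffun (rcons_ffun x y) z).
Proof.
pose w := rcons_ffun (rcons_ffun x y) z.
pose w' := rcons_ffun (rcons_ffun x z) y.
have nh : normc (2^-1 : R[i]) = 2^-1.
  rewrite normcV; congr _^-1.
  have -> : (2 : R[i]) = (2 : R)%:C by rewrite rmorph_nat.
  by rewrite /= expr0n addr0 sqrtr_sqr ger0_norm.
have -> : N k.+1 (rcons_ffun x (y + z)) = N k.+2 (2^-1 *: w + 2^-1 *: w').
  rewrite -scalerDr !rcons_ffunD !rcons_ffunZ (addrC z y) B4.
  congr (N k.+1 (rcons_ffun _ _)); last by rewrite scalerA divff ?scale1r.
  by rewrite scalerDr -scalerDl half_half scale1r.
apply: le_trans (is_normD (normN _) _ _) _.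
rewrite !(is_normZ (normN _)) nh /w' -normN_swap -/w; lra.
Qed.

(** Duplicating the last functional is adjoint to adding the last two coordinates, which maps unit
    ball into unit ball by [normN_merge]. *)
Lemma dual_norm_A4 : law_A4 (@dual_norm R F N).
Proof.
move=> k l m; apply/le_anti/andP; split; apply: le_dual_norm => x.
- rewrite -(rcons_belast x) -(rcons_belast (belast_ffun x)).
  move: (belast_ffun (belast_ffun x)) (belast_ffun x ord_max) (x ord_max).
  move=> {x} x y z x1; exists (rcons_ffun x (y + z)).
    exact: le_trans (normN_merge _ _ _) x1.
  by rewrite !dual_pair_rcons linearD addrA.
- rewrite -(rcons_belast x); move: (belast_ffun x) (x ord_max) => {x} x y x1.
  (* Splitting [y] into two equal halves preserves the norm exactly, by (B4), and addition recovers
     [y]. *)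
  exists (rcons_ffun (rcons_ffun x (2^-1 *: y)) (2^-1 *: y)).
    by rewrite B4 scalerA divff ?scale1r.
  by rewrite !dual_pair_rcons -addrA -linearD -scalerDl half_half scale1r.
Qed.

End DualNorm.

Theorem theorem2p33 (R : realType) (F : normedModType R[i])
    (N : forall k : nat, {ffun 'I_k -> F} -> R) :
  dual_multi_normed N -> multi_Banach (dual_norm N).
Proof.
move=> dmN; split; last exact: dual_complete.
split; [split|exact: dual_norm_A1|exact: dual_norm_A2|exact: dual_norm_A3
  |exact: dual_norm_A4].
- exact: dual_norm_is_norm.
- exact: dual_norm1.
Qed.
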